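(* Let $m\ge 2$ and $k\ge 1$ be integers. The minimal desingularization of $\mathbb{P}(1,m,mk+m-1)$ is the complete toric surface whose fan in $\mathbb{Z}^2$ has rays generated by $$\Delta(1)=\left\{\begin{bmatrix}1\\ 0\end{bmatrix},\begin{bmatrix}0\\ -1\end{bmatrix},\begin{bmatrix}-1\\ -(k+1)\end{bmatrix},v_0,\ldots,v_m\right\},\qquad v_j=\begin{bmatrix}-j\\ -(jk+j-1)\end{bmatrix}\ (0\le j\le m).$$
   Context: Let $e_1,e_2$ be the standard basis of $\mathbb{Z}^2$. For relatively prime positive integers $m<n$, $\mathbb{P}(1,m,n)$ is the complete toric surface whose fan in $\mathbb{Z}^2$ has rays generated by $u_1=e_1$, $u_2=e_2$, $u_0=-me_1-ne_2$, the maximal cones being $\sigma_i$ ($i=0,1,2$), where $\sigma_i$ is generated by the two vectors $u_j$ with $j\ne i$. A complete fan in $\mathbb{Z}^2$ is determined by its set $\Delta(1)$ of primitive ray generators: the maximal cones are spanned by pairs of angularly adjacent rays. A two-dimensional cone with primitive generators $v,w$ is non-singular iff $\det|v\; w|=\pm1$. The minimal desingularization of a toric surface is the toric surface given by the coarsest refinement of its fan (fewest rays) all of whose cones are non-singular. *)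

(* Defs.v *)
From HB Require Import structures.
From mathcomp Require Import all_boot all_order all_algebra.
From mathcomp Require Import boolp classical_sets cardinality reals.

Set Implicit Arguments.
Unset Strict Implicit.
Unset Printing Implicit Defensive.

Import Order.TTheory GRing.Theory Num.Theory.

Local Open Scope classical_set_scope.
Local Open Scope ring_scope.

(* A toric surface is represented by its fan: a set of cones in N_R = R^2,
   where the lattice is N = Z^2. *)

Definition vec2 (a b : int) : 'cV[int]_2 := \col_(i < 2) nth 0 [:: a; b] i.

Definition primitive (v : 'cV[int]_2) : Prop := gcdz (v 0 0) (v 1 0) = 1.

Definition det2 (v w : 'cV[int]_2) : int := \det (row_mx v w : 'M[int]_2).

Definition toR (R : realType) (v : 'cV[int]_2) : 'cV[R]_2 :=
  map_mx (intr : int -> R) v.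
Arguments toR R v : clear implicits.

(* In particular [cone R [::]] is the cone {0}. *)
Definition cone (R : realType) (s : seq 'cV[int]_2) : set 'cV[R]_2 :=
  [set x | exists2 c : nat -> R, (forall i, 0 <= c i)
           & x = \sum_(i < size s) c i *: toR R (nth 0 s i)].
Arguments cone R s : clear implicits.

Definition strongly_convex (R : realType) (sigma : set 'cV[R]_2) : Prop :=
  forall x, sigma x -> sigma (- x) -> x = 0.

Definition rational_polyhedral (R : realType) (sigma : set 'cV[R]_2) : Prop :=
  exists s, sigma = cone R s.

(* tau is the intersection of sigma with u^perp for some u in the dual cone
   of sigma. *)
Definition is_face (R : realType) (tau sigma : set 'cV[R]_2) : Prop :=
  exists2 u : 'rV[R]_2, (forall x, sigma x -> 0 <= (u *m x) 0 0)
    & tau = sigma `&` [set x | (u *m x) 0 0 = 0].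

Record is_fan (R : realType) (Delta : set (set 'cV[R]_2)) : Prop := IsFan {
  fan_finite : finite_set Delta;
  fan_cone : forall sigma, Delta sigma ->
    rational_polyhedral sigma /\ strongly_convex sigma;
  fan_face : forall sigma tau, Delta sigma -> is_face tau sigma -> Delta tau;
  fan_inter : forall sigma tau, Delta sigma -> Delta tau ->
    is_face (sigma `&` tau) sigma /\ is_face (sigma `&` tau) tau }.

Definition support (R : realType) (Delta : set (set 'cV[R]_2)) : set 'cV[R]_2 :=
  \bigcup_(sigma in Delta) sigma.

Definition is_complete_fan (R : realType) (Delta : set (set 'cV[R]_2)) : Prop :=
  is_fan Delta /\ support Delta = setT.

(* Delta(1), each ray being recorded by its primitive generator. *)
Definition ray_generators (R : realType) (Delta : set (set 'cV[R]_2)) :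
    set 'cV[int]_2 :=
  [set v | primitive v /\ Delta (cone R [:: v])].

(* The rays v, w are angularly adjacent in S, with w following v
   counterclockwise at an angle less than pi. *)
Definition adjacent (R : realType) (S : set 'cV[int]_2) (v w : 'cV[int]_2) :
    Prop :=
  [/\ S v, S w, 0 < det2 v w
    & forall u, S u -> cone R [:: v; w] (toR R u) -> u = v \/ u = w].

(* The complete fan determined by a set S of primitive ray generators. *)
Definition fan_of_rays (R : realType) (S : set 'cV[int]_2) :
    set (set 'cV[R]_2) :=
  [set sigma | [\/ sigma = cone R [::],
                   exists2 v, S v & sigma = cone R [:: v]
                 | exists v w, adjacent R S v w /\ sigma = cone R [:: v; w]]].
Arguments fan_of_rays R S : clear implicits.

Definition nonsingular_cone (R : realType) (sigma : set 'cV[R]_2) : Prop :=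
  [\/ sigma = cone R [::],
      exists2 v, primitive v & sigma = cone R [:: v]
    | exists v w, `|det2 v w| = 1 /\ sigma = cone R [:: v; w]].

Definition nonsingular_fan (R : realType) (Delta : set (set 'cV[R]_2)) : Prop :=
  forall sigma, Delta sigma -> nonsingular_cone sigma.

Definition refines (R : realType) (Delta' Delta : set (set 'cV[R]_2)) : Prop :=
  support Delta' = support Delta /\
  forall sigma', Delta' sigma' -> exists2 sigma, Delta sigma & sigma' `<=` sigma.

Definition nonsingular_refinement (R : realType)
    (Delta Delta' : set (set 'cV[R]_2)) : Prop :=
  [/\ is_fan Delta', refines Delta' Delta & nonsingular_fan Delta'].

(* Coarsest among the nonsingular refinements, and with the fewest rays. *)
Definition minimal_desingularization (R : realType)
    (Delta Delta' : set (set 'cV[R]_2)) : Prop :=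
  nonsingular_refinement Delta Delta' /\
  forall Delta'', nonsingular_refinement Delta Delta'' ->
    refines Delta'' Delta' /\
    (ray_generators Delta' #<= ray_generators Delta'')%card.

(* The fan of P(1,m,n): the cones sigma_0, sigma_1, sigma_2 and their faces. *)
Definition fan_P1 (R : realType) (m n : nat) : set (set 'cV[R]_2) :=
  let u1 := vec2 1 0 in
  let u2 := vec2 0 1 in
  let u0 := vec2 (- m%:Z) (- n%:Z) in
  [set tau | [\/ is_face tau (cone R [:: u1; u2]),
                 is_face tau (cone R [:: u0; u2])
               | is_face tau (cone R [:: u0; u1])]].
Arguments fan_P1 R m n : clear implicits.

Definition v_ray (k j : nat) : 'cV[int]_2 :=
  vec2 (- j%:Z) (- (j%:Z * k%:Z + j%:Z - 1)).

Definition resolution_rays (m k : nat) : set 'cV[int]_2 :=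
  [set vec2 1 0; vec2 0 (-1); vec2 (-1) (- (k%:Z + 1))] `|`
  [set v | exists2 j : nat, (j <= m)%N & v = v_ray k j].

(* Main.v *)
Require Import Defs.
From mathcomp Require Import all_boot all_order all_algebra.
From mathcomp Require Import boolp classical_sets cardinality reals.
From mathcomp Require Import zify ring lra.

(* Going round the origin from (1, 0), each of the listed rays has determinant
   1 with the next one, so they span a complete non-singular fan, which refines
   that of P(1, m, mk + m - 1). Each listed ray r is moreover irreducible in
   the monoid of lattice points of every cone of P(1, m, mk + m - 1) containing
   it: some integral linear form is positive on that cone and takes the value 1
   at r. A non-singular cone of a refinement that contains r writes r as a
   nonnegative integral combination of its generators, so irreducibility forces
   r to be one of them. Thus every non-singular refinement contains all the
   listed rays, and none of its cones can have one of them in its interior. *)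

Set Implicit Arguments.
Unset Strict Implicit.
Unset Printing Implicit Defensive.

Import Order.TTheory GRing.Theory Num.Theory.

Local Open Scope classical_set_scope.
Local Open Scope ring_scope.

(** * Determinants of pairs of plane vectors *)

(** Stated over any commutative ring, so that the same expression serves lattice vectors and real
    vectors and commutes with [toR]. Its sign encodes angular order. *)
Definition cross (A : comNzRingType) (x y : 'cV[A]_2) : A :=
  x 0 0 * y 1 0 - x 1 0 * y 0 0.

Lemma col2P (A : Type) (x y : 'cV[A]_2) :
  x 0 0 = y 0 0 -> x 1 0 = y 1 0 -> x = y.
Proof.
move=> h0 h1; apply/colP => i; case: i => [[|[|//]] hi].
- by rewrite (_ : Ordinal hi = 0) //; apply: val_inj.
- by rewrite (_ : Ordinal hi = 1) //; apply: val_inj.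
Qed.

Lemma vec2E0 a b : vec2 a b 0 0 = a. Proof. by rewrite mxE. Qed.
Lemma vec2E1 a b : vec2 a b 1 0 = b. Proof. by rewrite mxE. Qed.

Lemma det2E v w : det2 v w = cross v w.
Proof.
rewrite /det2 /cross (expand_det_row _ 0) !big_ord_recl big_ord0 /cofactor.
rewrite !det_mx11 !mxE /= addr0 expr0 expr1 mul1r mulN1r.
have e1 : split (0 : 'I_(1 + 1)) = inl 0.
  by case: splitP => // j _; congr inl; exact: ord1.
have e2 : split (lift 0 0 : 'I_(1 + 1)) = inr 0.
  by case: splitP => // j; rewrite ?ord1 // => _; congr inr; exact: ord1.
have e3 : lift 0 0 = 1 :> 'I_2 by exact: val_inj.
have e4 : lift (lift 0 0) 0 = 0 :> 'I_(1 + 1) by exact: val_inj.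
rewrite e4 !e1 !e2 !e3; ring.
Qed.

Lemma crossC (A : comNzRingType) (x y : 'cV[A]_2) : cross y x = - cross x y.
Proof. by rewrite /cross; ring. Qed.

Lemma crossxx (A : comNzRingType) (x : 'cV[A]_2) : cross x x = 0.
Proof. by rewrite /cross; ring. Qed.

(** * Cones with at most two generators and their lattice points *)

Section Plane.
Variable R : realType.
Implicit Types (x y z : 'cV[R]_2) (v w : 'cV[int]_2).

Lemma toRE v i : toR R v i 0 = (v i 0)%:~R.
Proof. by rewrite mxE. Qed.

Lemma cross_toR v w : cross (toR R v) (toR R w) = (cross v w)%:~R.
Proof. by rewrite /cross !toRE rmorphB !rmorphM. Qed.

Lemma crossDl a b x y z : cross (a *: x + b *: y) z = a * cross x z + b * cross
  y z.
Proof. by rewrite /cross !mxE; ring. Qed.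

Lemma crossDr a b x y z : cross z (a *: x + b *: y) = a * cross z x + b * cross
  z y.
Proof. by rewrite /cross !mxE; ring. Qed.

Lemma crossZl a x z : cross (a *: x) z = a * cross x z.
Proof. by rewrite /cross !mxE; ring. Qed.

Lemma crossZr a x z : cross z (a *: x) = a * cross z x.
Proof. by rewrite /cross !mxE; ring. Qed.

Lemma cramer x y z : cross x y != 0 ->
  z = (cross z y / cross x y) *: x + (cross x z / cross x y) *: y.
Proof.
by rewrite /cross => h; apply: col2P; rewrite !mxE; field.
Qed.

Lemma cone0E x : cone R [::] x <-> x = 0.
Proof.
split=> [[c _ ->]|->]; first by rewrite big_ord0.
by exists (fun=> 0); rewrite ?big_ord0.
Qed.

Lemma cone1E v x :
  cone R [:: v] x <-> exists2 a : R, 0 <= a & x = a *: toR R v.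
Proof.
split=> [[c c0 ->]|[a a0 ->]].
  by exists (c 0%N); rewrite // big_ord_recl big_ord0 addr0.
by exists (fun=> a); rewrite // big_ord_recl big_ord0 addr0.
Qed.

Lemma cone2E v w x : cone R [:: v; w] x <->
  exists a b : R, [/\ 0 <= a, 0 <= b & x = a *: toR R v + b *: toR R w].
Proof.
split=> [[c c0 ->]|[a [b [a0 b0 ->]]]].
  by exists (c 0%N), (c 1%N); rewrite !big_ord_recl big_ord0 addr0.
exists (fun i => if i == 0%N then a else b) => [i|]; first by case: ifP.
by rewrite !big_ord_recl big_ord0 addr0.
Qed.

Lemma cone2C v w : cone R [:: v; w] = cone R [:: w; v].
Proof.
by apply/seteqP; split=> x /cone2E [a [b [a0 b0 ->]]]; apply/cone2E;
  exists b, a; rewrite addrC.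
Qed.

(** By Cramer's rule, the two cross products on the right are the coordinates of [x] in the basis
    [v], [w], up to the positive factor [cross v w]. *)
Lemma cone_pos v w x : 0 < cross v w -> cone R [:: v; w] x <->
  0 <= cross x (toR R w) /\ 0 <= cross (toR R v) x.
Proof.
move=> h; have hR : 0 < cross (toR R v) (toR R w) by rewrite cross_toR ltr0z.
split=> [/cone2E [a [b [a0 b0 ->]]]|[h1 h2]].
  by rewrite crossDl crossDr !crossxx !mulr0 addr0 add0r !mulr_ge0 // ltW.
apply/cone2E; exists (cross x (toR R w) / cross (toR R v) (toR R w)),
  (cross (toR R v) x / cross (toR R v) (toR R w)).
by split; rewrite ?divr_ge0 ?(ltW hR) //; apply: cramer; rewrite gt_eqF.
Qed.

Lemma cone_pos_int v w u : 0 < cross v w -> cone R [:: v; w] (toR R u) <->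
  0 <= cross u w /\ 0 <= cross v u.
Proof. by move=> h; rewrite cone_pos // !cross_toR !ler0z. Qed.

Lemma cone1_gen v : cone R [:: v] (toR R v).
Proof. by apply/cone1E; exists 1; rewrite ?scale1r. Qed.

Lemma cone2_genl v w : cone R [:: v; w] (toR R v).
Proof.
by apply/cone2E; exists 1, 0; split; rewrite ?ler01 // scale1r scale0r addr0.
Qed.

Lemma cone2_genr v w : cone R [:: v; w] (toR R w).
Proof. by rewrite cone2C; exact: cone2_genl. Qed.

Lemma cone1_0 v : cone R [:: v] 0.
Proof. by apply/cone1E; exists 0; rewrite ?scale0r. Qed.

Lemma cone2_0 v w : cone R [:: v; w] 0.
Proof. by apply/cone2E; exists 0, 0; rewrite !scale0r addr0. Qed.

Lemma cone2_sub (v w v' w' : 'cV[int]_2) :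
  cone R [:: v'; w'] (toR R v) -> cone R [:: v'; w'] (toR R w) ->
  cone R [:: v; w] `<=` cone R [:: v'; w'].
Proof.
move=> /cone2E [a [b [a0 b0 ev]]] /cone2E [c [d [c0 d0 ew]]] x.
move=> /cone2E [s [t [s0 t0 ->]]]; apply/cone2E.
exists (s * a + t * c), (s * b + t * d); split.
- by rewrite addr_ge0 // mulr_ge0.
- by rewrite addr_ge0 // mulr_ge0.
- rewrite ev ew; apply: col2P; rewrite !mxE; ring.
Qed.

Lemma cone1_sub2 (v v' w' : 'cV[int]_2) :
  cone R [:: v'; w'] (toR R v) -> cone R [:: v] `<=` cone R [:: v'; w'].
Proof.
move=> /cone2E [a [b [a0 b0 ev]]] x /cone1E [s s0 ->]; apply/cone2E.
exists (s * a), (s * b); rewrite !mulr_ge0 //; split=> //.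
by rewrite ev scalerDr !scalerA.
Qed.

Lemma cone1_scale v w (a : R) :
  0 < a -> toR R v = a *: toR R w -> cone R [:: v] = cone R [:: w].
Proof.
move=> a0 e; apply/seteqP; split=> x /cone1E [s s0 ->]; apply/cone1E.
  by exists (s * a); rewrite ?mulr_ge0 ?(ltW a0) // e scalerA.
exists (s / a); first by rewrite divr_ge0 // ltW.
by rewrite e scalerA mulfVK // gt_eqF.
Qed.

Lemma toR_eq0 v : toR R v = 0 -> v = 0.
Proof.
move=> h; apply: col2P; apply: (@intr_inj R).
- by rewrite -toRE h !mxE.
- by rewrite -toRE h !mxE.
Qed.

(** Determinant 1 is a Bezout relation between the coordinates of [v], and also between those of
    [w]. *)
Lemma cross1_primitive v w : cross v w = 1 -> primitive v /\ primitive w.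
Proof.
rewrite /cross /primitive => h.
have H (a b c d : int) : a * d - b * c = 1 -> gcdz a b = 1.
  move=> e; have : (gcdz a b %| a * d - b * c)%Z.
    by rewrite rpredB // dvdz_mulr // ?dvdz_gcdl ?dvdz_gcdr.
  by rewrite e dvdz1 /gcdz /= => /eqP ->.
split; first exact: (H _ _ (w 0 0) (w 1 0)).
by apply: (H _ _ (- v 0 0) (- v 1 0)); rewrite -h; ring.
Qed.

Lemma primitive_neq0 v : primitive v -> toR R v != 0.
Proof.
by move=> h; apply/eqP => /toR_eq0 e; move: h; rewrite e /primitive !mxE.
Qed.

(** Since [w] is primitive, Bezout coefficients turn the vanishing of the determinant into [v = t w]
    with [t] an integer. Primitivity of [v] gives [t = 1] or [t = -1], and [t = a >= 0] fixes the
    sign. *)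
Lemma primitive_ray_inj v w (a : R) : primitive v -> primitive w -> 0 <= a ->
  toR R v = a *: toR R w -> v = w.
Proof.
move=> pv pw a0 e.
have [p [q pq]] := Bezoutz (w 0 0) (w 1 0); rewrite pw in pq.
pose t := p * v 0 0 + q * v 1 0.
have c0 : v 0 0 * w 1 0 - v 1 0 * w 0 0 = 0.
  by apply: (@intr_inj R); rewrite -[LHS]cross_toR e crossZl crossxx mulr0.
have e0 : v 0 0 = t * w 0 0.
  rewrite -[LHS]mulr1 -pq /t; apply/eqP; rewrite -subr_eq0; apply/eqP.
  transitivity (q * (v 0 0 * w 1 0 - v 1 0 * w 0 0)); first by ring.
  by rewrite c0 mulr0.
have e1 : v 1 0 = t * w 1 0.
  rewrite -[LHS]mulr1 -pq /t; apply/eqP; rewrite -subr_eq0; apply/eqP.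
  transitivity (- p * (v 0 0 * w 1 0 - v 1 0 * w 0 0)); first by ring.
  by rewrite c0 mulr0.
have t1 : `|t| = 1.
  by move: pv; rewrite /primitive e0 e1 -mulz_gcdr pw mulr1 abszE.
have ta : (t%:~R : R) = a.
  have /eqP w0 := primitive_neq0 pw; apply/eqP; rewrite -subr_eq0.
  apply/negPn/negP => h; apply: w0.
  apply: (scalerI h); rewrite scaler0 scalerBl -e; apply: col2P;
    rewrite !mxE ?e0 ?e1 intrM; ring.
have t0 : 0 <= t by rewrite -(ler0z R) ta.
move: t1; rewrite ger0_norm // => t1.
by apply: col2P; rewrite ?e0 ?e1 t1 mul1r.
Qed.

End Plane.

(** * Faces of cones with at most two generators *)

Section Faces.
Variable R : realType.
Implicit Types (x y z : 'cV[R]_2) (v w : 'cV[int]_2) (u : 'rV[R]_2).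

Lemma mulmx00Dr u a b x y :
  (u *m (a *: x + b *: y)) 0 0 = a * (u *m x) 0 0 + b * (u *m y) 0 0.
Proof. by rewrite mulmxDr -!scalemxAr !mxE. Qed.

Lemma mulmx00Zr u a x : (u *m (a *: x)) 0 0 = a * (u *m x) 0 0.
Proof. by rewrite -scalemxAr !mxE. Qed.

(** [is_face] asks for a supporting form given as a row vector. This one vanishes on the line of
    [x], so it cuts out an edge of a cone generated by [x] and another vector. *)
Definition cross_form x : 'rV[R]_2 := \row_(j < 2) nth 0 [:: - x 1 0; x 0 0] j.

Lemma cross_formE x y : (cross_form x *m y) 0 0 = cross x y.
Proof.
rewrite mxE !big_ord_recl big_ord0 !mxE /= /cross.
rewrite (_ : lift 0 0 = 1 :> 'I_2); last exact: val_inj.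
by ring.
Qed.

Lemma is_face_refl (sigma : set 'cV[R]_2) : is_face sigma sigma.
Proof.
exists 0 => [x _|]; first by rewrite mul0mx mxE.
by apply/seteqP; split=> x => [sx|[]//]; split=> //=; rewrite mul0mx mxE.
Qed.

Lemma face_sub (tau sigma : set 'cV[R]_2) : is_face tau sigma -> tau `<=` sigma.
Proof. by move=> [u _ ->] x []. Qed.

Lemma face_rayl v w : 0 < cross v w -> is_face (cone R [:: v]) (cone R [:: v;
  w]).
Proof.
move=> h; have hR : 0 < cross (toR R v) (toR R w) by rewrite cross_toR ltr0z.
exists (cross_form (toR R v)) => [x|];
  first by rewrite cross_formE => /(cone_pos _ h) [].
apply/seteqP; split=> x => [/cone1E [a a0 ->]|[/cone2E [a [b [a0 b0 ->]]]] /=].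
  split; last by rewrite /= cross_formE crossZr crossxx mulr0.
  by apply/cone2E; exists a, 0; split; rewrite // scale0r addr0.
rewrite cross_formE crossDr crossxx mulr0 add0r => /eqP;
  rewrite mulf_eq0 (gt_eqF hR) orbF.
by move=> /eqP ->; apply/cone1E; exists a; rewrite // scale0r addr0.
Qed.

Lemma face_rayr v w : 0 < cross v w -> is_face (cone R [:: w]) (cone R [:: v;
  w]).
Proof.
move=> h; have hR : 0 < cross (toR R v) (toR R w) by rewrite cross_toR ltr0z.
exists (- cross_form (toR R w)) => [x|].
  by rewrite mulNmx mxE cross_formE -crossC => /(cone_pos _ h) [].
apply/seteqP; split=> x => [/cone1E [a a0 ->]|[/cone2E [a [b [a0 b0 ->]]]] /=].
  split; last by rewrite /= mulNmx mxE cross_formE crossZr crossxx mulr0 oppr0.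
  by apply/cone2E; exists 0, a; split; rewrite // scale0r add0r.
rewrite mulNmx mxE cross_formE -crossC crossDl crossxx mulr0 addr0 => /eqP.
rewrite mulf_eq0 (gt_eqF hR) orbF.
by move=> /eqP ->; apply/cone1E; exists b; rewrite // scale0r add0r.
Qed.

(** The sum of the supporting forms of the two edges vanishes on the cone at the apex only. *)
Lemma face_zero v w : 0 < cross v w -> is_face (cone R [::]) (cone R [:: v; w]).
Proof.
move=> h; have hR : 0 < cross (toR R v) (toR R w) by rewrite cross_toR ltr0z.
have E x : ((cross_form (toR R v) - cross_form (toR R w)) *m x) 0 0 =
    cross (toR R v) x + cross x (toR R w).
  by rewrite mulmxBl mxE [X in _ + X]mxE !cross_formE -[X in _ + X]crossC.
exists (cross_form (toR R v) - cross_form (toR R w)) => [x|].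
  by rewrite E => /(cone_pos _ h) [? ?]; rewrite addr_ge0.
apply/seteqP; split=> x => [/cone0E ->|[/cone2E [a [b [a0 b0 ->]]]] /=].
  by split; [exact: cone2_0|rewrite /= mulmx0 mxE].
rewrite E crossDl crossDr !crossxx !mulr0 add0r addr0 -mulrDl => /eqP.
rewrite mulf_eq0 (gt_eqF hR) orbF addr_eq0 => /eqP e; apply/cone0E.
have b00 : b = 0 by lra.
have a00 : a = 0 by lra.
by rewrite a00 b00 !scale0r addr0.
Qed.

(** The scalar product with [v] is a supporting form, positive on the ray away from 0. *)
Lemma face_zero1 v : toR R v != 0 -> is_face (cone R [::]) (cone R [:: v]).
Proof.
move=> v0; exists ((toR R v)^T).
  move=> x /cone1E [a a0 ->]; rewrite mulmx00Zr mulr_ge0 // mxE.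
  by apply: sumr_ge0 => i _; rewrite mxE -expr2 sqr_ge0.
apply/seteqP; split=> x => [/cone0E ->|[/cone1E [a a0 ->]]].
  by split; [exact: cone1_0|rewrite /= mulmx0 mxE].
rewrite /= mulmx00Zr => /eqP; rewrite mulf_eq0 => /orP[/eqP ->|].
  by apply/cone0E; rewrite scale0r.
rewrite mxE psumr_eq0 => [/allP h|i _]; last by rewrite mxE -expr2 sqr_ge0.
case/eqP: v0; apply/colP => i; have := h i (mem_index_enum _).
by rewrite [X in X * _]mxE -expr2 sqrf_eq0 => /eqP ->; rewrite mxE.
Qed.

Lemma faces_zero (tau : set 'cV[R]_2) :
  is_face tau (cone R [::]) -> tau = cone R [::].
Proof.
move=> [u _ ->]; apply/seteqP; split=> x => [[]//|/cone0E ->].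
by split; [exact/cone0E|rewrite /= mulmx0 mxE].
Qed.

Lemma faces_ray v (tau : set 'cV[R]_2) : is_face tau (cone R [:: v]) ->
  tau = cone R [::] \/ tau = cone R [:: v].
Proof.
move=> [u u0 ->].
have [e|e] := eqVneq ((u *m toR R v) 0 0) 0; [right|left]; apply/seteqP; split.
- by move=> x [].
- by move=> x /[dup] /cone1E [a a0 ->] h; split; rewrite //= mulmx00Zr e mulr0.
- move=> x [/cone1E [a a0 ->]] /=; rewrite mulmx00Zr => /eqP.
  rewrite mulf_eq0 (negPf e) orbF => /eqP ->.
  by apply/cone0E; rewrite scale0r.
- move=> x /cone0E ->; split; [exact: cone1_0|by rewrite /= mulmx0 mxE].
Qed.

(** A supporting form has values [q], [p] at least 0 at the generators, so [a q + b p = 0] forces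
    both terms to vanish. The four cases for the vanishing of [p] and [q] give the four faces. *)
Lemma faces_cone2 v w (tau : set 'cV[R]_2) : is_face tau (cone R [:: v; w]) ->
  [\/ tau = cone R [::], tau = cone R [:: v], tau = cone R [:: w]
    | tau = cone R [:: v; w]].
Proof.
move=> [u u0 ->].
have := u0 _ (cone2_genl R v w); have := u0 _ (cone2_genr R v w).
set p := (u *m toR R w) 0 0; set q := (u *m toR R v) 0 0 => p0 q0.
have face0 : forall a b : R, 0 <= a -> 0 <= b -> a * q + b * p = 0 ->
    a * q = 0 /\ b * p = 0.
  move=> a b a0 b0 e; have := mulr_ge0 a0 q0; have := mulr_ge0 b0 p0; lra.
have [p00|p00] := eqVneq p 0; have [q00|q00] := eqVneq q 0.
- constructor 4; apply/seteqP; split=> [x []//|x /[dup] h /cone2E].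
  move=> [a [b [a0 b0 e]]]; split=> //=.
  by rewrite e mulmx00Dr -/p -/q p00 q00 !mulr0 addr0.
- constructor 3; apply/seteqP; split=> x.
    move=> [/cone2E [a [b [a0 b0 ->]]]] /=; rewrite mulmx00Dr -/p -/q.
    move=> /(face0 _ _ a0 b0) [/eqP + _]; rewrite mulf_eq0 (negPf q00) orbF.
    by move=> /eqP ->; apply/cone1E; exists b; rewrite // scale0r add0r.
  move=> /cone1E [a a0 ->]; split; last by rewrite /= mulmx00Zr -/p p00 mulr0.
  by apply/cone2E; exists 0, a; split; rewrite // scale0r add0r.
- constructor 2; apply/seteqP; split=> x.
    move=> [/cone2E [a [b [a0 b0 ->]]]] /=; rewrite mulmx00Dr -/p -/q.
    move=> /(face0 _ _ a0 b0) [_ /eqP]; rewrite mulf_eq0 (negPf p00) orbF.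
    by move=> /eqP ->; apply/cone1E; exists a; rewrite // scale0r addr0.
  move=> /cone1E [a a0 ->]; split; last by rewrite /= mulmx00Zr -/q q00 mulr0.
  by apply/cone2E; exists a, 0; split; rewrite // scale0r addr0.
- constructor 1; apply/seteqP; split=> x.
    move=> [/cone2E [a [b [a0 b0 ->]]]] /=; rewrite mulmx00Dr -/p -/q.
    move=> /(face0 _ _ a0 b0) [/eqP + /eqP].
    rewrite !mulf_eq0 (negPf q00) (negPf p00) !orbF => /eqP -> /eqP ->.
    by apply/cone0E; rewrite !scale0r addr0.
  by move=> /cone0E ->; split; [exact: cone2_0|rewrite /= mulmx0 mxE].
Qed.

End Faces.

(** * The fan determined by a set of primitive rays *)

Section FanOfRays.
Variables (R : realType) (S : set 'cV[int]_2).
Implicit Types (x y z : 'cV[R]_2) (v w : 'cV[int]_2).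

Lemma adjacent_cross_gt0 v w : adjacent R S v w -> 0 < cross v w.
Proof. by case=> _ _; rewrite det2E. Qed.

(** The sign conditions make [y] a nonnegative combination of [x] and [z], by Cramer's rule in that
    basis. *)
Lemma cone2_between (x y z : 'cV[R]_2) v w :
  0 < cross v w -> 0 < cross x z -> 0 <= cross x y -> 0 <= cross y z ->
  cone R [:: v; w] x -> cone R [:: v; w] z -> cone R [:: v; w] y.
Proof.
move=> h xz xy yz /(cone_pos _ h) [x1 x2] /(cone_pos _ h) [z1 z2].
apply/(cone_pos _ h).
rewrite (@cramer _ x z y) ?gt_eqF // crossDl crossDr.
by split; rewrite addr_ge0 // mulr_ge0 // divr_ge0 // ltW.
Qed.

(** First, [x] is interior to the second cone too: otherwise [v'] or [w'] would be a ray of [S]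
    interior to the first one. Then, of [v] and [v'], the one closer in angle to [x] lies in the
    cone of the other pair, hence is one of its generators by adjacency; likewise for [w] and
    [w']. *)
Lemma adjacent_disjoint v w v' w' x :
  adjacent R S v w -> adjacent R S v' w' ->
  0 < cross (toR R v) x -> 0 < cross x (toR R w) -> cone R [:: v'; w'] x ->
  v = v' /\ w = w'.
Proof.
move=> A A' vx xw cx.
have h := adjacent_cross_gt0 A; have h' := adjacent_cross_gt0 A'.
have hR : 0 < cross (toR R v) (toR R w) by rewrite cross_toR ltr0z.
have hR' : 0 < cross (toR R v') (toR R w') by rewrite cross_toR ltr0z.
case: A A' => Sv Sw _ adj [Sv' Sw' _ adj'].
have cx' : cone R [:: v; w] x by apply/(cone_pos _ h); split; exact: ltW.
have [x1 x2] := (cone_pos _ h').1 cx.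
have v'x : 0 < cross (toR R v') x.
  rewrite lt_neqAle x2 andbT eq_sym; apply/eqP => e.
  have {}x1 : 0 < cross x (toR R w').
    rewrite lt_neqAle x1 andbT eq_sym; apply/eqP => e'; move: vx.
    rewrite (@cramer _ (toR R v') (toR R w') x) ?gt_eqF // e e' !mul0r.
    by rewrite !scale0r addr0 /cross !mxE !mulr0 subrr ltxx.
  move: cx => /cone2E [a [b [a0 b0 ex]]].
  move: e x1; rewrite ex crossDl crossDr !crossxx !mulr0 addr0 add0r => /eqP.
  rewrite mulf_eq0 (gt_eqF hR') orbF => /eqP b00.
  rewrite pmulr_lgt0 // => a1.
  have ex' : x = a *: toR R v' by rewrite ex b00 scale0r addr0.
  move: vx xw; rewrite ex' crossZl crossZr !pmulr_rgt0 // => vx xw.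
  have : cone R [:: v; w] (toR R v') by apply/(cone_pos _ h); split; exact: ltW.
  by move=> /(adj _ Sv') [e|e]; move: vx xw; rewrite e crossxx ltxx.
have xw' : 0 < cross x (toR R w').
  rewrite lt_neqAle x1 andbT eq_sym; apply/eqP => e.
  move: cx => /cone2E [a [b [a0 b0 ex]]].
  move: e v'x; rewrite ex crossDl crossDr !crossxx !mulr0 addr0 add0r => /eqP.
  rewrite mulf_eq0 (gt_eqF hR') orbF => /eqP a00.
  rewrite pmulr_lgt0 // => b1.
  have ex' : x = b *: toR R w' by rewrite ex a00 scale0r add0r.
  move: vx xw; rewrite ex' crossZl crossZr !pmulr_rgt0 // => vx xw.
  have : cone R [:: v; w] (toR R w') by apply/(cone_pos _ h); split; exact: ltW.
  by move=> /(adj _ Sw') [e|e]; move: vx xw; rewrite e crossxx ltxx.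
have vNw' : v <> w' by move=> e; move: xw' vx; rewrite e crossC; lra.
have wNv' : w <> v' by move=> e; move: v'x xw; rewrite e crossC; lra.
split.
- have [vv'|vv'] := lerP 0 (cross (toR R v) (toR R v')).
    have := cone2_between h vx vv' (ltW v'x) (cone2_genl _ _ _) cx'.
    by move=> /(adj _ Sv') [//|e]; case: wNv'.
  have v'v : 0 <= cross (toR R v') (toR R v) by rewrite crossC; lra.
  have := cone2_between h' v'x v'v (ltW vx) (cone2_genl _ _ _) cx.
  by move=> /(adj' _ Sv) [].
- have [ww'|ww'] := lerP 0 (cross (toR R w') (toR R w)).
    have := cone2_between h xw (ltW xw') ww' cx' (cone2_genr _ _ _).
    by move=> /(adj _ Sw') [e|//]; case: vNw'.
  have w'w : 0 <= cross (toR R w) (toR R w') by rewrite crossC; lra.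
  have := cone2_between h' xw' (ltW xw) w'w cx (cone2_genr _ _ _).
  by move=> /(adj' _ Sw) [e|//]; case: wNv'.
Qed.

Lemma cone2_interior v w (a b : R) : 0 < cross v w -> 0 < a -> 0 < b ->
  let x := a *: toR R v + b *: toR R w in
  0 < cross (toR R v) x /\ 0 < cross x (toR R w).
Proof.
move=> h a0 b0 /=; rewrite crossDl crossDr !crossxx !mulr0 addr0 add0r
  cross_toR.
by rewrite !mulr_gt0 ?ltr0z.
Qed.

Lemma cone2_genP v w u (a : R) : 0 < a ->
  cone R [:: v; w] (a *: toR R u) -> cone R [:: v; w] (toR R u).
Proof.
move=> a0 /cone2E [b [c [b0 c0 e]]]; apply/cone2E; exists (b / a), (c / a).
rewrite !divr_ge0 ?(ltW a0) //; split=> //.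
apply: (scalerI (lt0r_neq0 a0)).
by rewrite e scalerDr !scalerA ![a * _]mulrC !divfK ?gt_eqF.
Qed.

Hypothesis primS : forall v, S v -> primitive v.

Lemma ray_meet u v : S u -> S v -> u <> v ->
  cone R [:: u] `&` cone R [:: v] = cone R [::].
Proof.
move=> Su Sv uv; apply/seteqP; split=> x; last first.
  by move=> /cone0E ->; split; exact: cone1_0.
move=> [/cone1E [a a0 ->] /cone1E [b b0 e]]; apply/cone0E.
have [->|an0] := eqVneq a 0; first by rewrite scale0r.
case: uv; apply: (@primitive_ray_inj R _ _ (b / a)); rewrite ?divr_ge0 //;
  [exact: primS|exact: primS|].
by apply: (scalerI an0); rewrite e scalerA mulrC divfK.
Qed.

Lemma ray_adjacent_meet u v w : S u -> adjacent R S v w -> u <> v -> u <> w ->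
  cone R [:: u] `&` cone R [:: v; w] = cone R [::].
Proof.
move=> Su [Sv Sw _ adj] uv uw; apply/seteqP; split=> x; last first.
  by move=> /cone0E ->; split; [exact: cone1_0|exact: cone2_0].
move=> [/cone1E [a a0 ->] h]; apply/cone0E.
have [->|an0] := eqVneq a 0; first by rewrite scale0r.
have ap : 0 < a by rewrite lt_neqAle eq_sym an0.
by have [] := adj u Su (cone2_genP ap h).
Qed.

(** A common point interior to the first cone makes the pairs equal by [adjacent_disjoint]. A
    nonzero common point on an edge of the first cone puts that edge in the second cone, where
    adjacency makes it a generator. *)
Lemma adjacent_meet v w v' w' : adjacent R S v w -> adjacent R S v' w' ->
  [\/ v = v' /\ w = w',
      exists r, [/\ r = v \/ r = w, r = v' \/ r = w'
        & cone R [:: v; w] `&` cone R [:: v'; w'] = cone R [:: r]]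
    | cone R [:: v; w] `&` cone R [:: v'; w'] = cone R [::] ].
Proof.
move=> A A'; have [e|ne] := pselect (v = v' /\ w = w'); first by constructor 1.
have h := adjacent_cross_gt0 A; have h' := adjacent_cross_gt0 A'.
have [Sv Sw _ adj] := A; have [Sv' Sw' _ adj'] := A'.
have vw : v <> w by move=> e; move: h; rewrite e crossxx ltxx.
have key x : (cone R [:: v; w] `&` cone R [:: v'; w']) x -> x = 0 \/
    exists r, [/\ r = v \/ r = w, r = v' \/ r = w' & cone R [:: r] x].
  move=> [/cone2E [a [b [a0 b0 ->]]] cx].
  have [b00|bn0] := eqVneq b 0.
    move: cx; rewrite b00 scale0r addr0 => cx.
    have [->|an0] := eqVneq a 0; first by left; rewrite scale0r.
    have ap : 0 < a by rewrite lt_neqAle eq_sym an0.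
    right; exists v; split; [by left| |by apply/cone1E; exists a].
    exact: adj' Sv (cone2_genP ap cx).
  have bp : 0 < b by rewrite lt_neqAle eq_sym bn0.
  have [a00|an0] := eqVneq a 0.
    move: cx; rewrite a00 scale0r add0r => cx.
    right; exists w; split; [by right| |by apply/cone1E; exists b].
    exact: adj' Sw (cone2_genP bp cx).
  have ap : 0 < a by rewrite lt_neqAle eq_sym an0.
  have [i1 i2] := cone2_interior h ap bp.
  by case: ne; exact: adjacent_disjoint A A' i1 i2 cx.
have [[r [rv rv']]|nr] :=
    pselect (exists r, (r = v \/ r = w) /\ (r = v' \/ r = w')).
  constructor 2; exists r; split=> //; apply/seteqP; split=> x.
    move=> /key [->|[s [sv sv']]]; first exact: cone1_0.
    suff -> : s = r by [].
    (* Two distinct common rays would make the pairs equal, which [ne] excludes, or reversed, which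
       the signs of the two cross products exclude. *)
    apply: contrapT => sr; move: h; rewrite lt0r => /andP [_]; move: h'.
    case: rv rv' sv sv' sr ne => -> [] -> [] -> [] e // sr ne;
      try (by case: sr); try (by case: ne);
      rewrite ?e crossC; lia.
  move=> cx; split.
    by move: x cx; apply: cone1_sub2; case: rv => ->;
      [exact: cone2_genl|exact: cone2_genr].
  by move: x cx; apply: cone1_sub2; case: rv' => ->;
    [exact: cone2_genl|exact: cone2_genr].
constructor 3; apply/seteqP; split=> x; last first.
  by move=> /cone0E ->; split; exact: cone2_0.
move=> /key [->|[r [rv rv' _]]]; first exact/cone0E.
by case: nr; exists r.
Qed.

Lemma adjacent_ray_face u v w : adjacent R S v w -> u = v \/ u = w ->
  is_face (cone R [:: u]) (cone R [:: v; w]).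
Proof.
by move=> /adjacent_cross_gt0 h [->|->]; [exact: face_rayl|exact: face_rayr].
Qed.

Lemma fan_of_rays_zero_face sigma : fan_of_rays R S sigma ->
  is_face (cone R [::]) sigma.
Proof.
case=> [->|[v Sv ->]|[v [w [A ->]]]]; first exact: is_face_refl.
  by apply: face_zero1; apply/primitive_neq0/primS.
exact/face_zero/(adjacent_cross_gt0 A).
Qed.

Lemma fan_of_rays_0 sigma : fan_of_rays R S sigma -> sigma 0.
Proof.
case=> [->|[v Sv ->]|[v [w [A ->]]]]; first exact/cone0E.
  exact: cone1_0.
exact: cone2_0.
Qed.

Lemma strongly_convex_cone2 v w :
  0 < cross v w -> strongly_convex (cone R [:: v; w]).
Proof.
move=> h x /(cone_pos _ h) [x1 x2] /(cone_pos _ h).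
have hR : 0 < cross (toR R v) (toR R w) by rewrite cross_toR ltr0z.
rewrite -scaleN1r crossZl crossZr !mulN1r !oppr_ge0 => -[x3 x4].
rewrite (@cramer _ (toR R v) (toR R w) x) ?gt_eqF //.
have -> : cross x (toR R w) = 0 by lra.
have -> : cross (toR R v) x = 0 by lra.
by rewrite !mul0r !scale0r addr0.
Qed.

Lemma strongly_convex_cone1 v :
  toR R v != 0 -> strongly_convex (cone R [:: v]).
Proof.
move=> v0 x /cone1E [a a0 ->] /cone1E [b b0] /eqP.
rewrite -scaleNr -subr_eq0 -scalerBl scaler_eq0 (negPf v0) orbF => /eqP e.
have -> : a = 0 by lra.
by rewrite scale0r.
Qed.

Lemma fan_of_rays_inter sigma tau :
  fan_of_rays R S sigma -> fan_of_rays R S tau ->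
  is_face (sigma `&` tau) sigma.
Proof.
move=> Fs Ft.
have zero : sigma `&` tau = cone R [::] -> is_face (sigma `&` tau) sigma.
  by move=> ->; exact: fan_of_rays_zero_face.
have zs := fan_of_rays_0 Fs; have zt := fan_of_rays_0 Ft.
case: (Fs) => [es|[v Sv es]|[v [w [A es]]]].
- apply: zero; rewrite es; apply/seteqP; split=> [x []//|x h].
  by split=> //; rewrite (cone0E x).1.
- case: (Ft) => [et|[v' Sv' et]|[v' [w' [A' et]]]].
  + apply: zero; rewrite et; apply/seteqP; split=> [x []//|x h].
    by split=> //; rewrite (cone0E x).1.
  + have [e|ne] := pselect (v = v').
      by rewrite es et e setIid; exact: is_face_refl.
    by apply: zero; rewrite es et; exact: ray_meet.
  + have [e|ne] := pselect (v = v' \/ v = w').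
      rewrite es et setIidl; first exact: is_face_refl.
      by apply: cone1_sub2; case: e => ->;
        [exact: cone2_genl|exact: cone2_genr].
    by apply: zero; rewrite es et; apply: ray_adjacent_meet => // e;
      apply: ne; [left|right].
- case: (Ft) => [et|[v' Sv' et]|[v' [w' [A' et]]]].
  + apply: zero; rewrite et; apply/seteqP; split=> [x []//|x h].
    by split=> //; rewrite (cone0E x).1.
  + have [e|ne] := pselect (v' = v \/ v' = w).
      rewrite es et setIidr; first exact: adjacent_ray_face.
      by apply: cone1_sub2; case: e => ->;
        [exact: cone2_genl|exact: cone2_genr].
    by apply: zero; rewrite es et setIC; apply: ray_adjacent_meet => // e;
      apply: ne; [left|right].
  + rewrite es et; case: (adjacent_meet A A') => [[-> ->]|[r [rv _ ->]]|e].
    * by rewrite setIid; exact: is_face_refl.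
    * exact: adjacent_ray_face.
    * by move: zero; rewrite es et; apply.
Qed.

Lemma fan_of_rays_fan : finite_set S -> is_fan (fan_of_rays R S).
Proof.
move=> finS; split.
- apply: (@sub_finite_set _ _ ([set cone R [::]] `|`
    ((fun v => cone R [:: v]) @` S) `|`
    ((fun p => cone R [:: p.1; p.2]) @` (S `*` S)))).
    move=> sigma [->|[v Sv ->]|[v [w [[Sv Sw _ _] ->]]]].
    + by left; left.
    + by left; right; exists v.
    + by right; exists (v, w).
  rewrite !finite_setU; split; first split.
  + exact: finite_set1.
  + exact: finite_image.
  + exact/finite_image/finite_setX.
- move=> sigma [->|[v Sv ->]|[v [w [A ->]]]]; (split; first by eexists).
  + by move=> x /cone0E.
  + by apply/strongly_convex_cone1/primitive_neq0/primS.
  + exact/strongly_convex_cone2/(adjacent_cross_gt0 A).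
- move=> sigma tau [->|[v Sv ->]|[v [w [A ->]]]].
  + by move=> /faces_zero ->; constructor 1.
  + by move=> /faces_ray [->|->]; [constructor 1|constructor 2; exists v].
  + have [Sv Sw _ _] := A; move=> /faces_cone2 [->|->|->|->].
    * by constructor 1.
    * by constructor 2; exists v.
    * by constructor 2; exists w.
    * by constructor 3; exists v, w.
- move=> sigma tau Fs Ft; split; first exact: fan_of_rays_inter.
  by rewrite setIC; exact: fan_of_rays_inter.
Qed.

Lemma ray_generators_fan_of_rays : ray_generators (fan_of_rays R S) = S.
Proof.
apply/seteqP; split=> v; last first.
  by move=> Sv; split; [exact: primS|constructor 2; exists v].
move=> [pv [e|[w Sw e]|[w [w' [A e]]]]].
- have := cone1_gen R v; rewrite e => /cone0E /eqP.
  by rewrite (negPf (primitive_neq0 R pv)).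
- have := cone1_gen R v; rewrite e => /cone1E [a a0 /primitive_ray_inj ->] //.
  exact: primS.
- have h := adjacent_cross_gt0 A.
  have := cone2_genl R w w'; have := cone2_genr R w w'.
  rewrite -e => /cone1E [a a0 ew'] /cone1E [b b0 ew].
  have : 0 < cross (toR R w) (toR R w') by rewrite cross_toR ltr0z.
  by rewrite ew ew' crossZl crossZr crossxx !mulr0 ltxx.
Qed.

End FanOfRays.

(** * The listed rays: cyclic order and irreducibility *)

Section Resolution.
Variables (R : realType) (m k : nat).
Hypotheses (hm : (2 <= m)%N) (hk : (1 <= k)%N).
Implicit Types (x y z : 'cV[R]_2) (u v w r g : 'cV[int]_2).

Let S := resolution_rays m k.
Let e1 := vec2 1 0.
Let p := vec2 (-1) (- (k%:Z + 1)).
Let q := vec2 0 (-1).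

Lemma v_rayE0 j : v_ray k j 0 0 = - j%:Z. Proof. exact: vec2E0. Qed.

Lemma v_rayE1 j : v_ray k j 1 0 = 1 - j%:Z * (k%:Z + 1).
Proof. by rewrite /v_ray vec2E1; ring. Qed.

Definition resolution_raysE := (v_rayE0, v_rayE1, vec2E0, vec2E1).

(** The counterclockwise tour of the listed rays, given explicitly so that its properties are
    checked case by case. It is shown below to coincide with [adjacent]. *)
Inductive consecutive : 'cV[int]_2 -> 'cV[int]_2 -> Prop :=
| Consec_e1 : consecutive e1 (v_ray k 0)
| Consec_v j : (j < m)%N -> consecutive (v_ray k j) (v_ray k j.+1)
| Consec_m : consecutive (v_ray k m) p
| Consec_p : consecutive p q
| Consec_q : consecutive q e1.

(* The maximal cones of the fan of P(1, m, mk + m - 1): the ray u_0 is v_m. *)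
Inductive sector : 'cV[int]_2 -> 'cV[int]_2 -> Prop :=
| Sector12 : sector e1 (v_ray k 0)
| Sector20 : sector (v_ray k 0) (v_ray k m)
| Sector01 : sector (v_ray k m) e1.

Lemma resolution_raysP r : S r ->
  [\/ r = e1, r = q, r = p | exists2 j : nat, (j <= m)%N & r = v_ray k j].
Proof.
move=> [[[->|->]|->]|[j jm ->]];
  [constructor 1|constructor 2|constructor 3|] => //.
by constructor 4; exists j.
Qed.

Lemma ray_e1 : S e1. Proof. by left; left; left. Qed.
Lemma ray_q : S q. Proof. by left; left; right. Qed.
Lemma ray_p : S p. Proof. by left; right. Qed.
Lemma ray_v j : (j <= m)%N -> S (v_ray k j). Proof. by move=> h; right;
  exists j. Qed.

Lemma consecutive_rays v w : consecutive v w -> S v /\ S w.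
Proof.
case=> [|j jm|||]; split; try exact: ray_e1; try exact: ray_p; try exact: ray_q;
  by apply: ray_v; lia.
Qed.

(** The point of the list is that [v_ray k j] equals [v_ray k 0] plus [j] times [p]. Hence along
    this chain, and from its end to [p], the determinant is always that of [v_ray k 0] and [p],
    which is 1. *)
Lemma consecutive_cross v w : consecutive v w -> cross v w = 1.
Proof. by case=> [|j jm|||]; rewrite /cross !resolution_raysE ?intS; ring. Qed.

Lemma sector_cross_gt0 g g' : sector g g' -> 0 < cross g g'.
Proof. by case; rewrite /cross !resolution_raysE; nia. Qed.

Lemma resolution_rays_primitive v : S v -> primitive v.
Proof.
move=> /resolution_raysP [->|->|->|[j jm ->]].
- by have [] := cross1_primitive (consecutive_cross Consec_e1).
- by have [] := cross1_primitive (consecutive_cross Consec_q).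
- by have [] := cross1_primitive (consecutive_cross Consec_p).
- have [->|jm'] := eqVneq j m.
    by have [] := cross1_primitive (consecutive_cross Consec_m).
  have {}jm : (j < m)%N by rewrite ltn_neqAle jm'.
  by have [] := cross1_primitive (consecutive_cross (Consec_v jm)).
Qed.

Lemma consecutive_sector v w : consecutive v w -> exists g g',
  [/\ sector g g', cone R [:: g; g'] (toR R v) & cone R [:: g; g'] (toR R w)].
Proof.
have H g g' v' w' : sector g g' ->
    [/\ 0 <= cross v' g', 0 <= cross g v',
      0 <= cross w' g' & 0 <= cross g w'] ->
    exists g g', [/\ sector g g', cone R [:: g; g'] (toR R v')
      & cone R [:: g; g'] (toR R w')].
  move=> s [a b c d]; exists g, g'; split=> //;
    exact/(cone_pos_int _ _ (sector_cross_gt0 s)).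
case=> [|j jm|||]; [apply: H Sector12 _|apply: H Sector20 _|apply: H Sector01 _
  |apply: H Sector01 _|apply: H Sector01 _];
    rewrite /cross !resolution_raysE ?intS; split; nia.
Qed.

(* A linear form of value 1 at r and positive on the sector; it witnesses that
   r is an irreducible element of the monoid of lattice points. *)
Lemma height_form r g g' : S r -> sector g g' -> 0 <= cross r g' ->
  0 <= cross g r ->
  exists a b : int, [/\ a * r 0 0 + b * r 1 0 = 1,
    0 < a * g 0 0 + b * g 1 0 & 0 < a * g' 0 0 + b * g' 1 0].
Proof.
move=> /resolution_raysP Sr; case; rewrite /cross !resolution_raysE => h1 h2.
- exists 1, 1; split; try lia.
  case: Sr h1 h2 => [->|->|->|[j jm ->]]; rewrite !resolution_raysE; nia.
(* This form is constantly 1 on the line through all the [v_ray k j], whose direction is [p]. *)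
- exists (- (k%:Z + 1)), 1; split; try nia.
  case: Sr h1 h2 => [->|->|->|[j jm ->]]; rewrite !resolution_raysE; nia.
(* In the last sector each witness is the form equal to 1 at both ends of a consecutive pair: [q]
   and [e1], then [p] and [q], and finally [v_ray k m] and [p]. *)
- case: Sr h1 h2 => [->|->|->|[j jm ->]]; rewrite !resolution_raysE => h1 h2.
  + by exists 1, (-1); split; nia.
  + by exists k%:Z, (-1); split; nia.
  + by exists k%:Z, (-1); split; nia.
  (* The determinant of [v_ray k m] and [v_ray k j] is [j - m], so only the end of the chain lies in
     this sector. *)
  + have -> : j = m by nia.
    exists ((m%:Z - 1) * (k%:Z + 1) - 1), (1 - m%:Z); split; nia.
Qed.

(** The form is positive at every nonzero point of the cone, and its value at a lattice point is an
    integer. *)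
Lemma height_ge1 g g' v (a b : int) : 0 < a * g 0 0 + b * g 1 0 ->
  0 < a * g' 0 0 + b * g' 1 0 -> cone R [:: g; g'] (toR R v) ->
  toR R v != 0 -> 1 <= a * v 0 0 + b * v 1 0.
Proof.
move=> hg hg' /cone2E [s [t [s0 t0 e]]] v0.
pose f x : R := a%:~R * x 0 0 + b%:~R * x 1 0.
have fE w : f (toR R w) = (a * w 0 0 + b * w 1 0)%:~R.
  by rewrite /f !toRE rmorphD !rmorphM.
suff : 0 < f (toR R v) by rewrite fE ltr0z; lia.
have -> : f (toR R v) = s * f (toR R g) + t * f (toR R g').
  by rewrite e /f !mxE; ring.
have fg : 0 < f (toR R g) by rewrite fE ltr0z.
have fg' : 0 < f (toR R g') by rewrite fE ltr0z.
have [s00|sn0] := eqVneq s 0.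
  have [t00|tn0] := eqVneq t 0.
    by move: v0; rewrite e s00 t00 !scale0r addr0 eqxx.
  by rewrite s00 mul0r add0r mulr_gt0 // lt_neqAle eq_sym tn0.
by apply: ltr_pwDl; rewrite ?mulr_gt0 ?mulr_ge0 ?(ltW fg') // lt_neqAle eq_sym
  sn0.
Qed.

(** Applying the form [h] of [height_form] gives [1 = a h(v) + b h(w)] with [h(v)] and [h(w)] at
    least 1, so [a] and [b] cannot both be positive. *)
Lemma resolution_ray_irreducible r g g' v w (a b : int) :
  S r -> sector g g' ->
  cone R [:: g; g'] (toR R v) -> cone R [:: g; g'] (toR R w) ->
  toR R v != 0 -> toR R w != 0 -> 0 <= a -> 0 <= b ->
  toR R r = a%:~R *: toR R v + b%:~R *: toR R w -> a = 0 \/ b = 0.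
Proof.
move=> Sr s cv cw v0 w0 a0 b0 e.
have h := sector_cross_gt0 s.
have : cone R [:: g; g'] (toR R r).
  apply: (cone2_sub cv cw); apply/cone2E.
  by exists a%:~R, b%:~R; rewrite !ler0z.
move=> /(cone_pos_int _ _ h) [h1 h2].
have [c [d [r1 cg cg']]] := height_form Sr s h1 h2.
have hv := height_ge1 cg cg' cv v0.
have hw := height_ge1 cg cg' cw w0.
have er i : r i 0 = a * v i 0 + b * w i 0.
  apply: (@intr_inj R); rewrite -toRE e !mxE rmorphD !rmorphM.
  by [].
move: r1; rewrite !er => r1.
have {}r1 : a * (c * v 0 0 + d * v 1 0) + b * (c * w 0 0 + d * w 1 0) = 1.
  by rewrite -r1; ring.
move: r1 hv hw; set X := (X in a * X); set Y := (Y in _ + b * Y).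
nia.
Qed.

(** The denominator in Cramer's rule is 1, so the coordinates are integers, as irreducibility
    requires. *)
Lemma unimodular_coords v w u : cross v w = 1 ->
  toR R u = (cross u w)%:~R *: toR R v + (cross v u)%:~R *: toR R w.
Proof.
move=> h; rewrite -!cross_toR.
have hR : cross (toR R v) (toR R w) = 1 by rewrite cross_toR h.
by rewrite {1}(@cramer _ (toR R v) (toR R w) (toR R u)) hR ?divr1 ?oner_neq0.
Qed.

(** * Consecutive pairs are the adjacent ones, and their cones cover the plane *)

(** A listed ray in the cone of a consecutive pair is a nonnegative integral combination of the
    pair. Being irreducible, it lies on an edge. *)
Lemma consecutive_adjacent v w : consecutive v w -> adjacent R S v w.
Proof.
move=> c; have vw := consecutive_cross c; have [Sv Sw] := consecutive_rays c.
have h : 0 < cross v w by rewrite vw.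
have [pv pw] := cross1_primitive vw.
split; rewrite ?det2E // => u Su /(cone_pos_int _ _ h) [h1 h2].
have [g [g' [s cv cw]]] := consecutive_sector c.
have e := unimodular_coords u vw.
have pu := resolution_rays_primitive Su.
have [z|z] := resolution_ray_irreducible Su s cv cw (primitive_neq0 R pv)
  (primitive_neq0 R pw) h1 h2 e; move: e; rewrite z scale0r ?addr0 ?add0r => e.
- by right; apply: primitive_ray_inj pu pw _ e; rewrite ler0z.
- by left; apply: primitive_ray_inj pu pv _ e; rewrite ler0z.
Qed.

(** The cones are taken half-open: [0 < a] leaves out the far edge, so a point on a listed ray is
    assigned to the cone that starts there. This strictness is used in [unimodular_cone_sub]. *)
Lemma consecutive_cover x : x != 0 -> exists v w (a b : R),
  [/\ consecutive v w, 0 < a, 0 <= b & x = a *: toR R v + b *: toR R w].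
Proof.
move=> x0.
have H v w : consecutive v w ->
    0 < cross x (toR R w) -> 0 <= cross (toR R v) x -> exists v w (a b : R),
    [/\ consecutive v w, 0 < a, 0 <= b & x = a *: toR R v + b *: toR R w].
  move=> c h1 h2; exists v, w, (cross x (toR R w)), (cross (toR R v) x);
    split=> //.
  have hR : cross (toR R v) (toR R w) = 1 by rewrite cross_toR
    (consecutive_cross c).
  by rewrite {1}(@cramer _ (toR R v) (toR R w) x) hR ?divr1 ?oner_neq0.
have crq : cross x (toR R q) = - x 0 0 by rewrite /cross !toRE
  !resolution_raysE; ring.
have cre : cross x (toR R e1) = - x 1 0 by rewrite /cross !toRE
  !resolution_raysE; ring.
have crv0 : cross x (toR R (v_ray k 0)) = x 0 0.
  by rewrite /cross !toRE !resolution_raysE mul0r subr0; ring.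
have crv1 : x 0 0 = 0 -> cross x (toR R (v_ray k 1)) = x 1 0.
  by move=> h; rewrite /cross !toRE !resolution_raysE h; ring.
have [x0n|x0p|x00] := ltrgt0P (x 0 0); last first.
- have [x1n|x1p|x10] := ltrgt0P (x 1 0).
  + by apply: (H _ _ (@Consec_v 0%N (ltnW hm)));
      rewrite ?crv1 // crossC crv0 x00 oppr0.
  + by apply: (H _ _ Consec_q); rewrite ?cre ?[cross (toR R q) x]crossC ?crq;
      lra.
  + by case/eqP: x0; apply: col2P; rewrite mxE.
- have v_chain n : (n <= m)%N -> 0 <= cross (toR R (v_ray k n)) x \/
      exists v w (a b : R),
      [/\ consecutive v w, 0 < a, 0 <= b & x = a *: toR R v + b *: toR R w].
    elim: n => [_|n IH nm]; first by left; rewrite crossC crv0; lra.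
    have [vn|] := IH (ltnW nm); last by right.
    have [vS|vS] := lerP 0 (cross (toR R (v_ray k n.+1)) x); first by left.
    by right; apply: (H _ _ (Consec_v nm)); rewrite // crossC; lra.
  have [vm|//] := v_chain m (leqnn m).
  have [px|px] := ltrP 0 (cross x (toR R p)); first exact: (H _ _ Consec_m).
  by apply: (H _ _ Consec_p); [rewrite crq|rewrite crossC]; lra.
- have [x1n|x1p] := ltrP (x 1 0) 0.
  + by apply: (H _ _ Consec_q); rewrite ?cre ?[cross (toR R q) x]crossC ?crq;
      lra.
  + by apply: (H _ _ Consec_e1); rewrite ?crv0 // crossC cre; lra.
Qed.



Let Delta := fan_of_rays R S.
Let Delta0 := fan_P1 R m (m * k + m - 1)%N.

(** The point [v + w] is interior to the cone of [v] and [w]. Some consecutive pair covers it, and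
    [adjacent_disjoint] identifies the two pairs. *)
Lemma adjacent_consecutive v w : adjacent R S v w -> consecutive v w.
Proof.
move=> A; have h := adjacent_cross_gt0 A.
have hR : 0 < cross (toR R v) (toR R w) by rewrite cross_toR ltr0z.
have [i1 i2] := cone2_interior h (@ltr01 R) (@ltr01 R);
  rewrite !scale1r in i1 i2.
have x0 : toR R v + toR R w != 0.
  by apply/eqP => x0; move: i1; rewrite x0 /cross !mxE !mulr0 subrr ltxx.
have [r [r' [a [b [c a0 b0 e]]]]] := consecutive_cover x0.
have [] // := adjacent_disjoint A (consecutive_adjacent c) i1 i2.
  by apply/cone2E; exists a, b; rewrite ltW.
by move=> -> ->.
Qed.

(** * The listed rays give a complete non-singular refinement *)

Lemma resolution_fan : is_fan Delta.
Proof.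
apply: fan_of_rays_fan; first exact: resolution_rays_primitive.
rewrite /S /resolution_rays !finite_setU; split.
  by split; [split|]; exact: finite_set1.
rewrite (_ : [set v | _] = v_ray k @` [set j | (j < m.+1)%N]); last first.
  by apply/seteqP; split=> v [j jm e]; exists j.
exact/finite_image/finite_II.
Qed.

Lemma support_resolution : Defs.support Delta = setT.
Proof.
apply/seteqP; split=> // x _; have [->|x0] := eqVneq x 0.
  by exists (cone R [::]); [constructor 1|apply/cone0E].
have [v [w [a [b [c a0 b0 e]]]]] := consecutive_cover x0.
exists (cone R [:: v; w]).
  by constructor 3; exists v, w; split=> //; exact: consecutive_adjacent.
by apply/cone2E; exists a, b; rewrite ltW.
Qed.

Lemma nonsingular_resolution : nonsingular_fan Delta.
Proof.
move=> sigma [->|[v Sv ->]|[v [w [A ->]]]]; first by constructor 1.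
  by constructor 2; exists v => //; exact: resolution_rays_primitive.
constructor 3; exists v, w; split=> //.
by rewrite det2E (consecutive_cross (adjacent_consecutive A)) normr1.
Qed.

Lemma v_ray_0 : v_ray k 0 = vec2 0 1.
Proof. by rewrite /v_ray; congr vec2; ring. Qed.

(** Since [2 <= m], the subtraction in [nat] is not truncated. *)
Lemma v_ray_m : v_ray k m = vec2 (- m%:Z) (- (m * k + m - 1)%N%:Z).
Proof. by rewrite /v_ray; congr vec2; lia. Qed.

Lemma sector_P1 g g' : sector g g' -> Delta0 (cone R [:: g; g']).
Proof.
case; rewrite ?v_ray_0 ?v_ray_m.
- by constructor 1; exact: is_face_refl.
- by constructor 2; rewrite cone2C; exact: is_face_refl.
- by constructor 3; exact: is_face_refl.
Qed.

Lemma P1_sector sigma : Delta0 sigma -> exists g g',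
  sector g g' /\ sigma `<=` cone R [:: g; g'].
Proof.
case=> /face_sub h.
- by exists e1, (v_ray k 0); split; [exact: Sector12|rewrite v_ray_0].
- exists (v_ray k 0), (v_ray k m); split; first exact: Sector20.
  by rewrite cone2C v_ray_0 v_ray_m.
- by exists (v_ray k m), e1; split; [exact: Sector01|rewrite v_ray_m].
Qed.

Lemma resolution_sub_sector sigma : Delta sigma -> exists g g',
  sector g g' /\ sigma `<=` cone R [:: g; g'].
Proof.
case=> [->|[v Sv ->]|[v [w [A ->]]]].
- exists e1, (v_ray k 0); split; first by constructor.
  by move=> x /cone0E ->; exact: cone2_0.
- have [v' [w' [a [b [c a0 b0 e]]]]] :=
    consecutive_cover (primitive_neq0 R (resolution_rays_primitive Sv)).
  have [g [g' [s cv cw]]] := consecutive_sector c; exists g, g'; split=> //.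
  apply: cone1_sub2; apply: (cone2_sub cv cw).
  by apply/cone2E; exists a, b; rewrite ltW.
- have [g [g' [s cv cw]]] := consecutive_sector (adjacent_consecutive A).
  by exists g, g'; split=> //; exact: cone2_sub.
Qed.

Lemma resolution_refines : refines Delta Delta0.
Proof.
have sub sigma : Delta sigma -> exists2 tau, Delta0 tau & sigma `<=` tau.
  move=> /resolution_sub_sector [g [g' [s h]]].
  by exists (cone R [:: g; g']) => //; exact: sector_P1.
split=> //; rewrite support_resolution; apply/esym/seteqP; split=> // x _.
have : Defs.support Delta x by rewrite support_resolution.
by move=> [sigma /sub [tau tD st] sx]; exists tau => //; exact: st.
Qed.

(** * Minimality among all non-singular refinements *)

Section Minimality.
Variable D : set (set 'cV[R]_2).
Hypothesis refD : nonsingular_refinement Delta0 D.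

(** By completeness some cone of [D] contains [r]. If it is two-dimensional, it lies in a sector and
    is unimodular, so irreducibility puts [r] on one of its edges, which is a face and hence in
    [D]. *)
Lemma refinement_ray r : S r -> D (cone R [:: r]).
Proof.
case: refD => fanD [suppD subD] nsD Sr.
have pr := resolution_rays_primitive Sr; have r0 := primitive_neq0 R pr.
have [tau Dt tr] : Defs.support D (toR R r).
  by rewrite suppD -resolution_refines.1 support_resolution.
have ray v (a : R) : 0 <= a -> toR R r = a *: toR R v ->
    cone R [:: r] = cone R [:: v].
  move=> a0 e; apply: (@cone1_scale _ _ _ a) => //.
  rewrite lt_neqAle a0 andbT eq_sym; apply: contraNneq r0 => a00.
  by rewrite e a00 scale0r.
have two v w : cross v w = 1 -> tau = cone R [:: v; w] -> D (cone R [:: r]).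
  move=> vw et; have h : 0 < cross v w by rewrite vw.
  have [sigma Ds ts] := subD _ Dt.
  have [g [g' [s sg]]] := P1_sector Ds.
  have cv : cone R [:: g; g'] (toR R v).
    by apply: sg; apply: ts; rewrite et; exact: cone2_genl.
  have cw : cone R [:: g; g'] (toR R w).
    by apply: sg; apply: ts; rewrite et; exact: cone2_genr.
  move: tr; rewrite et => /(cone_pos_int _ _ h) [h1 h2].
  have [pv pw] := cross1_primitive vw.
  have e := unimodular_coords r vw.
  have [z|z] := resolution_ray_irreducible Sr s cv cw (primitive_neq0 R pv)
    (primitive_neq0 R pw) h1 h2 e; move: e;
      rewrite z scale0r ?addr0 ?add0r => e.
  - rewrite (ray w _ _ e) ?ler0z //.
    by apply: (fan_face fanD Dt); rewrite et; exact: face_rayr.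
  - rewrite (ray v _ _ e) ?ler0z //.
    by apply: (fan_face fanD Dt); rewrite et; exact: face_rayl.
case: (nsD _ Dt) => [et|[v pv et]|[v [w [vw et]]]].
- by move: tr r0; rewrite et => /cone0E ->; rewrite eqxx.
- by move: tr; rewrite et => /cone1E [a a0 /ray ->] //; rewrite -et.
- rewrite det2E in vw; have [vw1|vw1] : cross v w = 1 \/ cross w v = 1.
  + by rewrite [cross w v]crossC; lia.
  + exact: two vw1 et.
  + by apply: two vw1 _; rewrite cone2C.
Qed.

(** The ray of [r] belongs to [D], so it meets the cone in a face. A supporting form vanishing at
    the interior point [r] vanishes at [v] and [w], which would then both lie on the ray of [r]. *)
Lemma no_interior_ray v w r : 0 < cross v w -> D (cone R [:: v; w]) -> S r ->
  0 < cross v r -> 0 < cross r w -> False.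
Proof.
move=> h Dvw /refinement_ray Dr vr rw; case: refD => fanD _ _.
have [_ [u u0 eu]] := fan_inter fanD Dr Dvw.
have cvw : cone R [:: v; w] (toR R r).
  by apply/(cone_pos_int _ _ h); split; exact: ltW.
have : (cone R [:: r] `&` cone R [:: v; w]) (toR R r).
  by split=> //; exact: cone1_gen.
rewrite eu => -[_ /=].
have vwR : 0 < cross (toR R v) (toR R w) by rewrite cross_toR ltr0z.
have vrR : 0 < cross (toR R v) (toR R r) by rewrite cross_toR ltr0z.
have rwR : 0 < cross (toR R r) (toR R w) by rewrite cross_toR ltr0z.
have uv := u0 _ (cone2_genl R v w); have uw := u0 _ (cone2_genr R v w).
rewrite (@cramer _ (toR R v) (toR R w) (toR R r)) ?gt_eqF // mulmx00Dr.
set a := _ / _; set b := _ / _ => e.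
have a0 : 0 < a by rewrite divr_gt0.
have b0 : 0 < b by rewrite divr_gt0.
have uv0 : (u *m toR R v) 0 0 = 0.
  apply/eqP; rewrite eq_le uv andbT -(pmulr_rle0 _ a0).
  by have := mulr_ge0 (ltW b0) uw; lra.
have : (cone R [:: r] `&` cone R [:: v; w]) (toR R v).
  by rewrite eu; split=> //; exact: cone2_genl.
move=> [/cone1E [c _ ec] _].
have uw0 : (u *m toR R w) 0 0 = 0.
  apply/eqP; rewrite eq_le uw andbT -(pmulr_rle0 _ b0).
  by have := mulr_ge0 (ltW a0) uv; lra.
have : (cone R [:: r] `&` cone R [:: v; w]) (toR R w).
  by rewrite eu; split=> //; exact: cone2_genr.
move=> [/cone1E [d _ ed] _].
by move: vwR; rewrite ec ed crossZl crossZr crossxx !mulr0 ltxx.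
Qed.

(** Take the half-open consecutive cone from [r] to [r'] that contains [v]. Then [r'] comes strictly
    after [v], and since it cannot be interior to the cone of [v] and [w], the vector [w] does not
    go past [r']. *)
Lemma unimodular_cone_sub v w : cross v w = 1 -> D (cone R [:: v; w]) ->
  exists2 sigma, Delta sigma & cone R [:: v; w] `<=` sigma.
Proof.
move=> vw Dvw; have h : 0 < cross v w by rewrite vw.
have [pv pw] := cross1_primitive vw.
have [r [r' [a [b [c a0 b0 e]]]]] := consecutive_cover (primitive_neq0 R pv).
have rr' : 0 < cross r r' by rewrite (consecutive_cross c).
have rr'R : cross (toR R r) (toR R r') = 1 by rewrite cross_toR
  (consecutive_cross c).
have [Sr Sr'] := consecutive_rays c.
have vwR : cross (toR R v) (toR R w) = 1 by rewrite cross_toR vw.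
have vr' : 0 < cross v r'.
  by rewrite -(ltr0z R) -cross_toR e crossDl rr'R crossxx mulr0 addr0 mulr1.
have r'w : cross r' w <= 0.
  by rewrite leNgt; apply/negP => /(no_interior_ray h Dvw Sr' vr').
exists (cone R [:: r; r']).
  by constructor 3; exists r, r'; split=> //; exact: consecutive_adjacent.
apply: cone2_sub; first by apply/cone2E; exists a, b; rewrite ltW.
have r'wR : cross (toR R r') (toR R w) <= 0 by rewrite cross_toR lerz0.
apply/(cone_pos _ rr'); split; first by rewrite crossC oppr_ge0.
(* Expanding [v] gives [1 = a cross(r, w) + b cross(r', w)] with second term at most 0. As [a > 0],
   the remaining sign condition for [w] follows. *)
move: vwR; rewrite e crossDl => f.
rewrite -(pmulr_rge0 _ a0).
have := mulr_ge0_le0 b0 r'wR; lra.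
Qed.

Lemma refinement_refines : refines D Delta.
Proof.
case: refD => fanD [suppD subD] nsD; split.
  by rewrite suppD resolution_refines.1.
move=> tau Dt; case: (nsD _ Dt) => [et|[v pv et]|[v [w [vw et]]]].
- by exists tau => //; rewrite et; constructor 1.
- have [r [r' [a [b [c a0 b0 e]]]]] := consecutive_cover (primitive_neq0 R pv).
  exists (cone R [:: r; r']).
    by constructor 3; exists r, r'; split=> //; exact: consecutive_adjacent.
  by rewrite et; apply: cone1_sub2; apply/cone2E; exists a, b; rewrite ltW.
- rewrite det2E in vw; have [vw1|vw1] : cross v w = 1 \/ cross w v = 1.
  + by rewrite [cross w v]crossC; lia.
  + by rewrite et; apply: unimodular_cone_sub; rewrite -?et.
  + by rewrite et cone2C; apply: unimodular_cone_sub; rewrite // cone2C -et.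
Qed.

End Minimality.

End Resolution.

Theorem corollary5p9 (R : realType) (m k : nat)
    (hm : (2 <= m)%N) (hk : (1 <= k)%N) :
  [/\ is_complete_fan (fan_of_rays R (resolution_rays m k)),
      ray_generators (fan_of_rays R (resolution_rays m k)) = resolution_rays m k
    & minimal_desingularization (fan_P1 R m (m * k + m - 1)%N)
        (fan_of_rays R (resolution_rays m k))].
Proof.
split.
- by split; [exact: resolution_fan|exact: support_resolution].
- by apply: ray_generators_fan_of_rays => v; exact: resolution_rays_primitive.
split.
  split; [exact: resolution_fan|exact: resolution_refines
    |exact: nonsingular_resolution].
move=> D refD; split; first exact: refinement_refines refD.
rewrite ray_generators_fan_of_rays; last first.
  by move=> v; exact: resolution_rays_primitive.
(* The bound on the number of rays comes from an inclusion: every listed ray is a ray of [D]. *)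
apply: subset_card_le => r Sr; split; first exact: resolution_rays_primitive Sr.
exact: refinement_ray refD _ Sr.
Qed.
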